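(* For $n\ge 3$ let $P$ be the probability measure on the alternating group $A_n$ that assigns mass $\frac{1}{2n-3}$ to each of the identity, the $3$-cycles $(i,n-1,n)$ and the $3$-cycles $(i,n,n-1)$, $1\le i\le n-2$, and mass $0$ to all other elements. Let $U_{A_n}$ be the uniform distribution on $A_n$. Then: (1) For every $c>0$ there is a sequence $\delta_n\to 0$ (as $n\to\infty$) such that $\|P^{*k}-U_{A_n}\|_{\mathrm{TV}}<\frac{1}{\sqrt 2}e^{-c}+\delta_n$ for all integers $k\ge (n-\frac32)(\log n+c)$. (2) For every $\epsilon\in(0,1)$, with $k_n=\lfloor(1+\epsilon)(n-\frac32)\log n\rfloor$, one has $\lim_{n\to\infty}\|P^{*k_n}-U_{A_n}\|_{\mathrm{TV}}=0$.
   Context: For probability measures $p,q$ on a finite group $G$, the convolution is $(p*q)(x)=\sum_{y\in G}p(xy^{-1})q(y)$, and $p^{*k}$ is the $k$-fold convolution of $p$ with itself. The total variation distance is $\|\mu-\nu\|_{\mathrm{TV}}=\sup_{A\subset\Omega}|\mu(A)-\nu(A)|$. $\log$ is the natural logarithm and $\lfloor x\rfloor$ is the floor of $x$. The measure $P$ depends on $n$, although this is suppressed in the notation. *)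

(* Defs.v *)
From HB Require Import structures.
From mathcomp Require Import all_boot all_order all_algebra.
From mathcomp Require Import all_fingroup all_solvable.
From mathcomp Require Import all_classical all_reals all_analysis.
Set Implicit Arguments.
Unset Strict Implicit.
Unset Printing Implicit Defensive.
Import Order.TTheory GRing.Theory Num.Theory.
Import numFieldNormedType.Exports.
Local Open Scope classical_set_scope.
Local Open Scope ring_scope.

(* A measure on a finite type is represented by its mass function. *)
Definition mass (R : realType) (T : finType) (mu : T -> R) (A : {set T}) : R :=
  \sum_(x in A) mu x.

Definition uniform_dist (R : realType) (T : finType) : T -> R :=
  fun=> #|T|%:R^-1.

Definition tv_dist (R : realType) (T : finType) (mu nu : T -> R) : R :=
  sup [set `|mass mu A - mass nu A| | A in [set: {set T}]].

Definition conv (R : realType) (gT : finGroupType) (p q : gT -> R) : gT -> R :=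
  fun x => \sum_(y : gT) p (x * y^-1)%g * q y.

(* The 0-fold convolution is the point mass at the identity, the neutral
   element of conv. *)
Fixpoint conv_pow (R : realType) (gT : finGroupType) (p : gT -> R) (k : nat) :
    gT -> R :=
  if k is k'.+1 then conv p (conv_pow p k') else fun x => (x == 1%g)%:R.

Definition altT (n : nat) : finGroupType := [subg 'Alt_('I_n)].

(* Products of permutations apply the left factor first, so for distinct
   i, a, b this is the 3-cycle i |-> a |-> b |-> i. *)
Definition cycle3 (T : finType) (i a b : T) : {perm T} :=
  (tperm i a * tperm i b)%g.

Lemma cycle3P (T : finType) (i a b : T) : i != a -> a != b -> i != b ->
  [/\ cycle3 i a b i = a, cycle3 i a b a = b, cycle3 i a b b = i &
      forall j, j != i -> j != a -> j != b -> cycle3 i a b j = j].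
Proof.
move=> ia ab ib; rewrite /cycle3; split=> [||| j ji ja jb]; rewrite !permM.
- by rewrite tpermL tpermD // eq_sym.
- by rewrite tpermR tpermL.
- by rewrite (tpermD ib ab) tpermR.
- by rewrite !tpermD // eq_sym.
Qed.

(* 'I_n is {0, ..., n-1}: the points 1, ..., n of the alternating group are
   shifted down by one, so a and b below are the points n-1 and n. *)
Definition in_supp (n : nat) (s : {perm 'I_n}) : bool :=
  (s == 1%g) ||
  [exists i : 'I_n, exists a : 'I_n, exists b : 'I_n,
    [&& (i < n - 2)%N, val a == (n - 2)%N, val b == (n - 1)%N &
        (s == cycle3 i a b) || (s == cycle3 i b a)]].

Definition P (R : realType) (n : nat) : altT n -> R :=
  fun x => if in_supp (sgval x) then (2 * n%:R - 3)^-1 else 0.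

(* Main.v *)
Require Import Defs.
From HB Require Import structures.
From mathcomp Require Import all_boot all_order all_algebra.
From mathcomp Require Import all_fingroup all_solvable.
From mathcomp Require Import all_classical all_reals all_analysis.
From mathcomp Require Import all_field ring lra zify.
Set Implicit Arguments.
Unset Strict Implicit.
Unset Printing Implicit Defensive.
Import Order.TTheory GRing.Theory Num.Theory.
Import numFieldNormedType.Exports.
Local Open Scope classical_set_scope.
Local Open Scope ring_scope.

(** By Cauchy-Schwarz, [4 TV^2 <= |A_n| * \sum_x P^{*k}(x)^2 - 1], and the
    right-hand side is a trace of [2k]-th powers.  Let [X_t] be the sum of the
    transpositions [(i t)] with [i < t] (a Jucys-Murphy element) and
    [s = (n-1 n)].  The sum of the support of [P] is [s (X_{n-1} + X_n)], where
    the factors commute, so its even powers are those of [X_{n-1} + X_n].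
    On a subspace of a unitary representation of [S_n] without nonzero vectors
    fixed by [S_m], the eigenvalues of [X_{n-1}] and [X_n] are integers at most
    [m - 2], and common eigenvectors have distinct eigenvalues, so that
    [X_{n-1} + X_n <= 2 m - 5].  In the regular representation the functions
    with no [S_{n-j}]-invariant part have codimension at most [C(n, j) n^j].
    Applied also to the representation twisted by the sign, this bounds the
    number of eigenvalues of absolute value above [2 n - 5 - 2 j], hence
    [4 TV^2 <= \sum_{j >= 1} C(n, j) n^j (1 - 2 j / (2 n - 3))^{2k}], which is
    at most [\sum_{j >= 1} e^{-2 c j} / j! <= 2 e^{-2 c}].
    Part (2) follows by letting [c] grow. *)

Local Notation conjC := Num.conj.

(** * Eigenvectors in stable subspaces *)

(** Matrices act on row vectors from the right, and [V] stands for its row space. *)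
Definition eig_in (C : fieldType) (N : nat) (V A : 'M[C]_N) (x : C) : Prop :=
  exists v : 'rV[C]_N, [/\ v != 0, (v <= V)%MS & v *m A = x *: v].

Lemma stable_eig_in (C : numClosedFieldType) (N : nat) (V A : 'M[C]_N) :
  V != 0 -> stablemx V A -> exists x, eig_in V A x.
Proof.
move=> V0 VA; have r0 : (0 < \rank V)%N by rewrite lt0n mxrank_eq0.
have [x /eigenvalueP[w wx w0]] := eigenvalue_closed (restrictmx V A) r0.
exists x, (w *m row_base V); split.
- by rewrite mulmx_free_eq0 ?row_base_free.
- by rewrite mulmx_sub // eq_row_base.
- apply/eigenspaceP; rewrite -sub_eigenspace_conjmx ?stablemx_row_base //;
    last exact: row_base_free.
  exact/eigenspaceP.
Qed.

(** With [stable_eig_in], this yields common eigenvectors of commuting matrices inside a stable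
    subspace. *)
Lemma stable_capmx_eigenspace (C : fieldType) (N : nat) (V A B : 'M[C]_N) x :
  stablemx V B -> comm_mx A B -> stablemx (V :&: eigenspace A x)%MS B.
Proof.
move=> VB AB; rewrite sub_capmx.
rewrite (submx_trans (submxMr _ (capmxSl _ _))) //=.
by apply: submx_trans (submxMr _ (capmxSr _ _)) (comm_mx_stable_eigenspace _ _).
Qed.

Lemma capmx_eigenspace_neq0 (C : fieldType) (N : nat) (V A : 'M[C]_N) x :
  eig_in V A x -> (V :&: eigenspace A x)%MS != 0.
Proof.
move=> [v [v0 vV /eigenspaceP vx]]; apply/rowV0Pn; exists v => //.
by rewrite sub_capmx vV.
Qed.

(** * Generation by transpositions *)

Lemma perm_on_tperm (T : finType) (B : {set T}) (x y : T) :
  x \in B -> y \in B -> perm_on B (tperm x y).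
Proof.
move=> xB yB; apply: fintype.subset_trans (tperm_on x y) _.
by apply/fintype.subsetP => z; rewrite !inE => /orP[] /eqP ->.
Qed.

(** Induction on the number of moved points: [g * tperm x (g x)] fixes [x] and moves no new
    point. *)
Lemma perm_on_ind (T : finType) (B : {set T}) (Q : {perm T} -> Prop) :
  Q 1%g -> (forall g h, Q g -> Q h -> Q (g * h)%g) ->
  {in B &, forall x y, Q (tperm x y)} -> forall g, perm_on B g -> Q g.
Proof.
move=> Q1 QM Qt g; have [k] := ubnP #|[pred x | g x != x]|.
elim: k g => // k IHk g; rewrite ltnS => gk gB.
have [/pred0P g1|/pred0Pn [x /= gx]] := boolP (pred0b [pred x | g x != x]).
  suff -> : g = 1%g by exact: Q1.
  by apply/permP => x; rewrite perm1; have /negbFE/eqP := g1 x.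
have xB : x \in B by apply: (fintype.subsetP gB).
have gxB : g x \in B by rewrite perm_closed.
suff : Q (g * tperm x (g x) * tperm x (g x))%g by rewrite -mulgA tperm2 mulg1.
apply: (QM); last exact: Qt.
apply: IHk; last by rewrite perm_onM // perm_on_tperm.
apply: leq_trans _ gk; apply: proper_card; apply/fintype.properP; split.
  apply/fintype.subsetP => z; rewrite !inE permM.
  apply: contra => /eqP gz; rewrite gz; case: tpermP => // zx.
    by rewrite -zx gz.
  by apply/eqP/(@perm_inj _ g); rewrite gz.
exists x; first by rewrite inE.
by rewrite inE permM tpermR eqxx.
Qed.

(** * Jucys-Murphy elements *)

Section JucysMurphy.

Variables (C : numClosedFieldType) (n N : nat) (a : {perm 'I_n} -> 'M[C]_N).
Hypothesis a1 : a 1%g = 1%:M.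
Hypothesis aM : forall g h, a (g * h)%g = a g *m a h.

Definition jm (t : 'I_n) : 'M[C]_N := \sum_(i < n | (i < t)%N) a (tperm i t).

(** Conjugation by such a [g] only permutes the transpositions [(i t)] with [i < t]. *)
Lemma comm_jm (t : 'I_n) (g : {perm 'I_n}) :
  g t = t -> (forall i : 'I_n, (g i < t)%N = (i < t)%N) -> comm_mx (jm t) (a g).
Proof.
move=> gt gi; rewrite /comm_mx /jm mulmx_suml mulmx_sumr.
rewrite [RHS](reindex_inj (@perm_inj _ g)) /=.
apply: eq_big => [i|i _]; first by rewrite gi.
rewrite -!aM; congr a.
by have := tpermJ i t g; rewrite gt conjgE => <-; rewrite mulKVg.
Qed.

Lemma comm_jm_tperm (t i j : 'I_n) :
  (i < t)%N -> (j < t)%N -> comm_mx (jm t) (a (tperm i j)).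
Proof.
move=> it jt; apply: comm_jm.
  by rewrite tpermD //; [move: it|move: jt]; apply: contraTneq => ->;
    rewrite ltnn.
by move=> k; case: tpermP => [->|->|]; rewrite ?it ?jt.
Qed.

Lemma comm_jm_jm (t u : 'I_n) : (u < t)%N -> comm_mx (jm t) (jm u).
Proof.
move=> ut; rewrite /comm_mx [jm u]/jm [LHS]mulmx_sumr [RHS]mulmx_suml.
by apply: eq_bigr => i iu; apply: comm_jm_tperm => //; apply: ltn_trans ut.
Qed.

Lemma a_tperm2 (i j : 'I_n) : a (tperm i j) *m a (tperm i j) = 1%:M.
Proof. by rewrite -aM tperm2 a1. Qed.

Section Adjacent.

Variables (t u : 'I_n).
Hypothesis tu : t = u.+1 :> nat.
Local Notation s := (a (tperm u t)).

(** Conjugation by [s] turns [(i u)] into [(i t)] for [i < u]; the one missing transposition is [s]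
    itself. *)
Lemma jm_rec : s *m jm u *m s + s = jm t.
Proof.
rewrite [jm t]/jm (bigD1 u) /= ?tu // addrC; congr (_ + _).
rewrite mulmx_sumr mulmx_suml; apply: eq_big => [i|i iu].
  by rewrite ltnS -(inj_eq val_inj) /= andbC -ltn_neqAle.
rewrite -!aM; congr a.
have iu0 : i != u by apply: contraTneq iu => ->; rewrite ltnn.
have it0 : i != t.
  by apply: contraTneq iu => ->; rewrite tu -leqNgt leqnSn.
have := tpermJ i u (tperm u t); rewrite conjgE tpermV mulgA => ->.
by rewrite tpermL tpermD // eq_sym.
Qed.

(** The degenerate affine Hecke relation, on which all the eigenvalue arguments rest. *)
Lemma jm_swap : s *m jm u = jm t *m s - 1%:M.
Proof. by rewrite -jm_rec mulmxDl -mulmxA a_tperm2 mulmx1 addrK. Qed.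

(* For a common eigenvector [v], with eigenvalues [x] for [jm u] and [y] for
   [jm t], the vector [(y - x) v s - v] is killed by [jm u - y]; it vanishes
   only if [v s = v] or [v s = - v]. *)
Lemma eig_in_jm_step (D : 'M[C]_N) (y : C) : (forall g, stablemx D (a g)) ->
  eig_in D (jm t) y ->
  eig_in D (jm u) y \/
  exists2 x, eig_in D (jm u) x & y = x + 1 \/ y = x - 1.
Proof.
move=> Dst Dy; have := capmx_eigenspace_neq0 Dy.
have utn : (u < t)%N by rewrite tu.
have Dju : stablemx D (jm u).
  rewrite /jm mulmx_sumr; apply: summx_sub => i _; exact: Dst.
have /stable_eig_in /[apply] := stable_capmx_eigenspace y Dju (comm_jm_jm utn).
move=> [x [v [v0 vE vx]]].
move: vE; rewrite sub_capmx => /andP[vD /eigenspaceP vy].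
have vs : v *m s *m jm u = y *: (v *m s) - v.
  by rewrite -mulmxA jm_swap mulmxBr mulmx1 mulmxA vy -scalemxAl.
set w := (y - x) *: (v *m s) - v.
have wy : w *m jm u = y *: w.
  rewrite /w mulmxBl -scalemxAl vs vx !scalerBr !scalerA mulrC -addrA.
  congr (_ + _).
  by rewrite -opprD -scalerDl subrK.
have [w0|w0] := eqVneq w 0; last first.
  left; exists w; split => //; rewrite addmx_sub ?scalemx_sub //.
    exact: submx_trans (submxMr _ vD) (Dst _).
  by rewrite eqmx_opp.
right; exists x; first by exists v.
have E1 : (y - x) *: (v *m s) = v by apply/eqP; rewrite -subr_eq0 -/w w0.
have E2 : (y - x) *: v = v *m s.
  by rewrite -{2}E1 -scalemxAl -mulmxA a_tperm2 mulmx1.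
have : ((y - x) ^+ 2 - 1) *: v = 0.
  by rewrite scalerBl expr2 -scalerA E2 E1 scale1r subrr.
move/eqP; rewrite scaler_eq0 (negPf v0) orbF subr_eq0 sqrf_eq1.
by case/orP => /eqP yx; [left|right]; rewrite -yx ?opprK addrC subrK.
Qed.

End Adjacent.

(** Induction on [t]: [jm] of the least point is an empty sum, and each step changes an eigenvalue
    by at most 1. *)
Lemma eig_in_jm_int (D : 'M[C]_N) (t : 'I_n) (y : C) :
  (forall g, stablemx D (a g)) -> eig_in D (jm t) y ->
  exists2 z : int, y = z%:~R & (z <= t%:Z)%R.
Proof.
move=> Dst; case: t => t tn; elim: t tn y => [|t IHt] tn y Dy.
  exists 0 => //; case: Dy => v [v0 _].
  rewrite /jm big1 // mulmx0 => /esym/eqP.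
  by rewrite scaler_eq0 (negPf v0) orbF => /eqP.
have tn' : (t < n)%N by apply: ltnW.
have [|/(IHt tn')[z -> zt]|[x /(IHt tn')[z -> zt]]] :=
  @eig_in_jm_step (Ordinal tn) (Ordinal tn') _ D y Dst Dy => //.
  by exists z => //; rewrite /= in zt *; lia.
case=> ->; [exists (z + 1)|exists (z - 1)]; rewrite ?rmorphD ?rmorphN //=;
  by rewrite /= in zt *; lia.
Qed.

Section NoInvariants.

Variables (D : 'M[C]_N) (m : nat).
Hypothesis m_gt1 : (1 < m)%N.
Hypothesis Dst : forall g, stablemx D (a g).
Hypothesis noinv : forall v : 'rV[C]_N, (v <= D)%MS ->
  (forall g, perm_on [set i : 'I_n | (i < m)%N] g -> v *m a g = v) -> v = 0.

Lemma stable_jm (t : 'I_n) : stablemx D (jm t).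
Proof. rewrite /jm mulmx_sumr; apply: summx_sub => i _; exact: Dst. Qed.

(* If [jm t] had an eigenvalue [z > m - 2] on [D], then [jm u - z] would be
   invertible on [D] for the predecessor [u] of [t], which makes the eigenspace
   stable under the adjacent transposition; the latter has no eigenvalue [-1]
   there, as [jm u] would have the eigenvalue [z + 1].  So the eigenspace would
   be fixed pointwise by all permutations of the points up to [t]. *)
Lemma eig_in_jm_bound (t : 'I_n) (z : int) : (m <= t.+2)%N ->
  eig_in D (jm t) z%:~R -> (z + 2 <= m%:Z)%R.
Proof.
have base (w : int) (r : 'I_n) : m = r.+2 -> eig_in D (jm r) w%:~R ->
    (w + 2 <= m%:Z)%R.
  move=> -> /(eig_in_jm_int Dst)[w' /eqP].
  by rewrite eqr_int => /eqP -> w'r; lia.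
(* When [m = t + 2] the integrality bound suffices; otherwise the induction hypothesis applies to
   the predecessor. *)
case: t => t tn /=; elim: t tn z => [|t IHt] tn z; rewrite leq_eqVlt;
  case/orP => [/eqP mt|mt] Dz; [exact: base Dz|by lia|exact: base Dz|].
have tn' : (t < n)%N by apply: ltnW.
pose T := Ordinal tn; pose u := Ordinal tn'.
rewrite leNgt; apply/negP => mz.
have Bno (z' : int) : z <= z' -> ~ eig_in D (jm u) z'%:~R.
  by move=> zz' /(IHt tn' _ _)-/(_ mt); lia.
pose s := a (tperm u T).
pose E := (D :&: eigenspace (jm T) z%:~R)%MS.
pose B := jm u - (z%:~R)%:M.
have BT : comm_mx (jm T) (jm u) by apply: comm_jm_jm.
(* [B] maps [E] into itself, injectively since [z] is no eigenvalue of [jm u] on [D]. *)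
have EB : (E *m B :=: E)%MS.
  have sub : (E *m B <= E)%MS.
    rewrite /B mulmxBr addmx_sub //.
      exact: stable_capmx_eigenspace (stable_jm u) BT.
    by rewrite eqmx_opp mul_mx_scalar scalemx_sub.
  apply/eqmxP; have [_ <-] := mxrank_leqif_eq sub; apply/eqP.
  have := mxrank_mul_ker E B; suff -> : (E :&: kermx B)%MS = 0.
    by rewrite mxrank0 addn0.
  apply/eqP/rowV0P => v; rewrite !sub_capmx => /andP[/andP[vD _] vB].
  apply/eqP/contraT => v0; case: (Bno z) => //; exists v; split => //.
  exact/eigenspaceP.
have swap (v : 'rV_N) : (v <= E)%MS -> v *m s *m B = - v.
  rewrite sub_capmx => /andP[_ /eigenspaceP vy].
  rewrite /B mulmxBr -mulmxA (@jm_swap T u) // mulmxBr mulmx1 mulmxA vy.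
  by rewrite mul_mx_scalar -scalemxAl addrAC subrr add0r.
(* Write [v = w' B] with [w'] in [E]. As [v s B = - v], the vector [v s + w'] of [D] is killed by
   [B], hence is zero. *)
have Es (v : 'rV_N) : (v <= E)%MS -> (v *m s <= E)%MS.
  move=> vE; have := vE; rewrite -EB => /submxP[w vw].
  have wE : (w *m E <= E)%MS by apply: submxMl.
  suff : v *m s + w *m E == 0.
    by rewrite addr_eq0 => /eqP ->; rewrite eqmx_opp.
  apply/contraT => v0; case: (Bno z) => //; exists (v *m s + w *m E).
  split => //; last first.
    apply/eigenspaceP; rewrite sub_kermx -/B mulmxDl swap // -mulmxA -vw.
    by rewrite addNr.
  rewrite addmx_sub ?(submx_trans wE) ?capmxSl //.
  apply: submx_trans (submxMr _ (submx_trans vE (capmxSl _ _))) (Dst _).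
(* The vector [d = v - v s] satisfies [d s = - d], so [swap] makes it an eigenvector of [jm u] for
   [z + 1] unless it vanishes. *)
have sE (v : 'rV_N) : (v <= E)%MS -> v *m s = v.
  move=> vE; apply/eqP; rewrite eq_sym -subr_eq0.
  have wE : (v - v *m s <= E)%MS by rewrite addmx_sub // eqmx_opp Es.
  apply/contraT => v0; case: (Bno (z + 1)); first by lia.
  exists (v - v *m s); split => //; first exact: submx_trans wE (capmxSl _ _).
  rewrite rmorphD /= scalerDl scale1r.
  have := swap _ wE; rewrite mulmxBl -[_ *m s *m s]mulmxA a_tperm2 // mulmx1.
  rewrite -[v *m s - v]opprB mulNmx => /oppr_inj.
  rewrite {1}/B mulmxBr mul_mx_scalar => /eqP.
  by rewrite subr_eq => /eqP ->; apply: addrC.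
(* For [i != u], [(i T)] is the conjugate of [(u T)] by [(i u)], which commutes with [jm T] and so
   preserves [E]. *)
have iE (i : 'I_n) (v : 'rV_N) : (i < T)%N -> (v <= E)%MS ->
    v *m a (tperm i T) = v.
  move=> iT vE; have [->|iu] := eqVneq i u; first exact: sE.
  have giE (w : 'rV_N) : (w <= E)%MS -> (w *m a (tperm i u) <= E)%MS.
    move=> wE; apply: submx_trans (submxMr _ wE) _.
    by apply: stable_capmx_eigenspace => //; apply: comm_jm_tperm.
  have := tpermJ u T (tperm i u); rewrite conjgE tpermV mulgA.
  rewrite tpermR tpermD; [|by apply: contraTneq iT => ->; rewrite ltnn|
    by apply/eqP => /(congr1 val) /=; lia].
  move=> <-; rewrite !aM !mulmxA sE ?giE //.
  by rewrite -mulmxA a_tperm2 mulmx1.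
have /rowV0Pn[v vE v0] := capmx_eigenspace_neq0 Dz.
case/negP: v0; apply/eqP/noinv; first exact: submx_trans vE (capmxSl _ _).
apply: perm_on_ind; first by rewrite a1 mulmx1.
  by move=> g h gv hv; rewrite aM mulmxA gv hv.
have tpE (i j : 'I_n) : (i < T)%N -> (j < T)%N -> v *m a (tperm i j) = v.
  move=> iT jT; have [->|ij] := eqVneq i j; first by rewrite tperm1 a1 mulmx1.
  have := tpermJ i T (tperm j T); rewrite conjgE tpermV mulgA tpermR.
  rewrite tpermD 1?eq_sym //; last by apply: contraTneq iT => ->; rewrite ltnn.
  by move=> <-; rewrite !aM !mulmxA !iE.
move=> i j; rewrite !inE => im jm'.
have le_T (k : 'I_n) : (k < m)%N -> (k < T)%N || (k == T).
  by move=> km; rewrite orbC -(inj_eq val_inj) -leq_eqVlt /=; lia.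
have /orP[iT|/eqP ->] := le_T i im; have /orP[jT|/eqP ->] := le_T j jm'.
- exact: tpE.
- exact: iE.
- by rewrite tpermC; apply: iE.
- by rewrite tperm1 a1 mulmx1.
Qed.

End NoInvariants.
End JucysMurphy.

(** * Sums of two adjacent Jucys-Murphy elements in a unitary action *)

Section HermitianAction.

Variables (C : numClosedFieldType) (n N : nat) (a : {perm 'I_n} -> 'M[C]_N).
Hypothesis a1 : a 1%g = 1%:M.
Hypothesis aM : forall g h, a (g * h)%g = a g *m a h.
Hypothesis aV : forall g, map_mx conjC (a g)^T = a g^-1%g.

Local Notation J := (jm a).

Lemma jm_hermitian (t : 'I_n) : map_mx conjC (J t)^T = J t.
Proof.
rewrite /jm !raddf_sum /=; apply: eq_bigr => i _.
by rewrite aV tpermV.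
Qed.

Lemma row_mul_conj_eq0 (v : 'rV[C]_N) :
  v *m map_mx conjC v^T = 0 -> v = 0.
Proof.
move/matrixP/(_ 0 0); rewrite !mxE => /eqP.
rewrite psumr_eq0 => [/allP v0|i _]; last by rewrite !mxE mul_conjC_ge0.
apply/rowP => i; have := v0 i (mem_index_enum _).
by rewrite !mxE mul_conjC_eq0 => /eqP.
Qed.

Variables (t u : 'I_n).
Hypothesis tu : t = u.+1 :> nat.

(* A common eigenvector of [J u] and [J t] for the same real eigenvalue [x]
   would satisfy [v s (J u - x) = - v] and [v (J u - x) = 0], which is
   impossible as [J u] is Hermitian. *)
Lemma eig_in_jm_sum (D : 'M[C]_N) (y : C) : (forall g, stablemx D (a g)) ->
  eig_in D (J t + J u) y ->
  exists z z' : int, [/\ y = (z + z')%:~R, z != z',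
    eig_in D (J t) z%:~R & eig_in D (J u) z'%:~R].
Proof.
move=> Dst Dy; have := capmx_eigenspace_neq0 Dy.
have utn : (u < t)%N by rewrite tu.
have tuC : comm_mx (J t + J u) (J u).
  by rewrite /comm_mx mulmxDl mulmxDr (comm_jm_jm aM utn).
have /stable_eig_in /[apply] :=
  stable_capmx_eigenspace y (stable_jm Dst u) tuC.
move=> [x [v [v0]]]; rewrite sub_capmx => /andP[vD /eigenspaceP vy] vx.
have vt : v *m J t = (y - x) *: v.
  by rewrite scalerBl -vx -vy mulmxDr addrK.
have Du : eig_in D (J u) x by exists v.
have Dt : eig_in D (J t) (y - x) by exists v.
have [z' xz' _] := eig_in_jm_int a1 aM Dst Du.
have [z yz _] := eig_in_jm_int a1 aM Dst Dt.
exists z, z'; rewrite -xz' -yz; split => //.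
  by rewrite rmorphD /= -xz' -yz subrK.
apply: contra_neq v0 => zz'; apply: row_mul_conj_eq0.
pose w := v *m a (tperm u t).
have wu : w *m J u = x *: w - v.
  rewrite /w -mulmxA (jm_swap a1 aM tu) mulmxBr mulmx1 mulmxA vt.
  by rewrite yz zz' -xz' -scalemxAl.
(* Now [v v^* = w (x - J u) v^*], and [(x - J u) v^* = 0] because [J u] is Hermitian and [x] is an
   integer. *)
have -> : v = x *: w - w *m J u by rewrite wu opprB addrC subrK.
rewrite -{1}mul_mx_scalar -mulmxBr -mulmxA.
suff -> : (x%:M - J u) *m map_mx conjC (x *: w - w *m J u)^T = 0.
  by rewrite mulmx0.
have -> : x *: w - w *m J u = v by rewrite wu opprB addrC subrK.
rewrite mulmxBl mul_scalar_mx -[X in X *m _](jm_hermitian u) -map_mxM.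
by rewrite -trmx_mul vx linearZ /= map_mxZ xz' rmorph_int subrr.
Qed.

End HermitianAction.

(** * Spectra of normal matrices *)

(** In a rank factorization [e = L U], idempotence forces [U L = 1], and [e] has the same trace as
    [U L]. *)
Lemma mxtrace_idem (F : fieldType) (N : nat) (e : 'M[F]_N) :
  e *m e = e -> \tr e = (\rank e)%:R.
Proof.
move=> ee; have [B BL] := row_fullP (col_base_full e).
have [B' RB'] := row_freeP (row_base_free e).
have RL : row_base e *m col_base e = 1%:M.
  have : B *m (col_base e *m row_base e *m (col_base e *m row_base e)) *m B'
      = B *m (col_base e *m row_base e) *m B' by rewrite mulmx_base ee.
  move: (col_base e) (row_base e) BL RB' => L U BL UB'.
  by rewrite !mulmxA BL mul1mx -!mulmxA UB' mulmx1.
by rewrite -{1}(mulmx_base e) mxtrace_mulC RL mxtrace1.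
Qed.

(** Codimension is subadditive under intersection, and the kernel of [e i] has codimension
    [\rank (e i)]. *)
Lemma codim_bigcap_kermx (F : fieldType) (N : nat) (I : finType)
    (A : pred I) (e : I -> 'M[F]_N) :
  (N <= \rank (\bigcap_(i | A i) kermx (e i))%MS
     + \sum_(i | A i) \rank (e i))%N.
Proof.
elim/big_rec2: _ => [|i V r _ IH]; first by rewrite mxrank1 addn0.
have := mxrank_sum_cap (kermx (e i)) V; rewrite mxrank_ker.
have := rank_leq_col (kermx (e i) + V)%MS.
have := rank_leq_row (e i).
lia.
Qed.

Lemma mxtrace_exp_spectral (C : numClosedFieldType) (N : nat) (M : 'M[C]_N) k :
  M \is normalmx -> \tr (M ^+ k) = \sum_i spectral_diag M 0 i ^+ k.
Proof.
move=> /orthomx_spectralP; set P := spectralmx M; set d := spectral_diag M.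
move=> MP; have -> : M ^+ k = invmx P *m diag_mx (map_mx (fun x => x ^+ k) d) *m P.
  elim: k => [|k IHk].
    rewrite expr0 (_ : diag_mx _ = 1%:M) ?mulmx1 ?mulVmx ?spectral_unit //.
    by apply/matrixP => i j; rewrite !mxE expr0.
  rewrite exprS IHk {1}MP -mulmxE !mulmxA mulmxK ?spectral_unit //.
  rewrite -(mulmxA (invmx P) (diag_mx d)). congr (_ *m _ *m _).
  by apply/matrixP => i j; rewrite mul_diag_mx !mxE exprS mulrnAr.
rewrite mxtrace_mulC mulKVmx ?spectral_unit // mxtrace_diag.
by apply: eq_bigr => i _; rewrite mxE.
Qed.

Lemma spectral_diag_eig (C : numClosedFieldType) (N : nat) (M : 'M[C]_N) i :
  M \is normalmx -> eig_in 1%:M M (spectral_diag M 0 i).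
Proof.
move=> /orthomx_spectralP; set P := spectralmx M; set d := spectral_diag M.
move=> MP; exists (row i P); split.
- rewrite rowE mulmx_free_eq0 ?row_free_unit ?spectral_unit //.
  by apply/eqP => /matrixP/(_ 0 i)/eqP; rewrite !mxE !eqxx oner_eq0.
- exact: submx1.
rewrite MP -row_mul !mulmxA mulmxV ?spectral_unit // mul1mx.
by apply/rowP => j; rewrite [LHS]mxE mul_diag_mx !mxE.
Qed.

(* The span of the eigenvectors whose eigenvalue violates [Q] meets [D]
   trivially. *)
Lemma card_spectral_diag (C : numClosedFieldType) (N : nat) (M D : 'M[C]_N)
    (Q : pred C) :
  M \is normalmx -> stablemx D M -> (forall x, eig_in D M x -> Q x) ->
  (#|[pred i | ~~ Q (spectral_diag M 0%R i)]| + \rank D <= N)%N.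
Proof.
move=> /orthomx_spectralP; set P := spectralmx M; set d := spectral_diag M.
move=> MP DM Qeig; set I := [pred i | _].
(* [K] projects onto the coordinates in [I], so the rows of [K *m P] span the offending
   eigenvectors. *)
pose K := diag_mx (\row_i (i \in I)%:R) : 'M[C]_N.
have KK : K *m K = K.
  apply/matrixP => i j; rewrite /K mul_diag_mx !mxE.
  by case: (i \in I); rewrite ?mul1r ?mul0r // mul0rn.
have rK : \rank (K *m P) = #|I|.
  rewrite mxrankMfree ?row_free_unit ?spectral_unit //.
  apply/eqP; rewrite -(eqr_nat C) -mxtrace_idem // mxtrace_diag.
  rewrite -sum1_card natr_sum [X in _ == X]big_mkcond /=; apply/eqP; apply: eq_bigr => i _.
  by rewrite mxE; case: (i \in I).
have KPM : K *m P *m M = diag_mx d *m (K *m P).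
  rewrite MP !mulmxA mulmxK ?spectral_unit //.
  by congr (_ *m _); rewrite /K diag_mxC.
have KD : ((K *m P) :&: D)%MS = 0.
  apply/eqP/contraT => KD0.
  have st : stablemx ((K *m P) :&: D)%MS M.
    rewrite sub_capmx; apply/andP; split.
      by apply: submx_trans (submxMr _ (capmxSl _ _)) _; rewrite KPM submxMl.
    by apply: submx_trans (submxMr _ (capmxSr _ _)) DM.
  have [x [v [v0]]] := stable_eig_in KD0 st.
  rewrite sub_capmx => /andP[/submxP[w vE] vD] vx.
  have Qx : Q x by apply: Qeig; exists v.
  have wx : w *m K *m diag_mx d = x *: (w *m K).
    apply: (can_inj (mulmxK (spectral_unit M))).
    rewrite -/P -scalemxAl -mulmxA -[w *m K *m P]mulmxA -vE -vx vE -mulmxA KPM.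
    by rewrite !mulmxA; congr (_ *m _); rewrite -!mulmxA diag_mxC.
  suff wK : w *m K = 0 by rewrite vE mulmxA wK mul0mx eqxx in v0.
  (* A nonzero coordinate [i] of [w *m K] has [i] in [I] and forces [x] to be the [i]-th eigenvalue,
     against [Q x]. *)
  apply/rowP => i; rewrite [RHS]mxE; apply/eqP/contraT => wi.
  have /rowP/(_ i) := wx; rewrite mul_mx_diag mxE [RHS]mxE mulrC.
  move=> /(mulIf wi) dx.
  move: wi; rewrite /K mul_mx_diag !mxE inE -/d dx Qx mulr0 eqxx //.
rewrite -rK -mxrank_sum_cap KD mxrank0 addn0; exact: rank_leq_col.
Qed.

(** * The trace of the powers *)

Lemma leq_ffact_exp (n m : nat) : (n ^_ m <= n ^ m)%N.
Proof.
elim: m n => [|m IHm] n; first by rewrite ffactn0.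
rewrite ffactnSr expnSr leq_mul //; exact: leq_subr.
Qed.

(** * Vectors without invariants under pointwise stabilizers *)

Section InvariantKernel.

Variables (C : numClosedFieldType) (n N : nat) (a : {perm 'I_n} -> 'M[C]_N).
Hypothesis a1 : a 1%g = 1%:M.
Hypothesis aM : forall g h, a (g * h)%g = a g *m a h.

(** Up to the factor [(n - #|A|)!], the projection onto the vectors fixed by the pointwise
    stabilizer of [A]. *)
Definition sym_sum (A : {set 'I_n}) : 'M[C]_N :=
  \sum_(h | perm_on (~: A) h) a h.

(** Intersecting over all sets of size [j], rather than fixing one, makes the subspace stable under
    every permutation. *)
Definition sym_ker (j : nat) : 'M[C]_N :=
  (\bigcap_(A : {set 'I_n} | #|A| == j) kermx (sym_sum A))%MS.

Lemma mul_sym_sum (g : {perm 'I_n}) (A : {set 'I_n}) :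
  a g *m sym_sum A = sym_sum (g @^-1: A) *m a g.
Proof.
rewrite /sym_sum mulmx_suml mulmx_sumr (reindex_inj (@conjg_inj _ g)) /=.
apply: eq_big => [h|h _]; last by rewrite -!aM conjgE mulKVg.
apply/fintype.subsetP/fintype.subsetP => hA x.
  rewrite !inE => hx; have := hA (g x).
  by rewrite !inE conjgE !permM permK (inj_eq perm_inj); apply.
rewrite !inE conjgE !permM -(inj_eq (@perm_inj _ g^-1%g)) permK => hx.
by have := hA (g^-1%g x); rewrite !inE permKV; apply.
Qed.

Lemma stable_sym_ker (j : nat) (g : {perm 'I_n}) : stablemx (sym_ker j) (a g).
Proof.
apply/sub_bigcapmxP => A /eqP Aj; rewrite sub_kermx -mulmxA mul_sym_sum mulmxA.
have -> : sym_ker j *m sym_sum (g @^-1: A) = 0; last by rewrite mul0mx.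
apply/sub_kermxP; apply: bigcapmx_inf; last exact: submx_refl.
by rewrite card_preimset ?Aj //; apply: perm_inj.
Qed.

(** For [A] the complement of the first [m] points, [sym_sum A] multiplies such a [v] by [m!] and
    also kills it. *)
Lemma sym_ker_noinv (m : nat) (v : 'rV[C]_N) : (m <= n)%N ->
  (v <= sym_ker (n - m))%MS ->
  (forall g, perm_on [set i : 'I_n | (i < m)%N] g -> v *m a g = v) -> v = 0.
Proof.
move=> mn /sub_bigcapmxP vD vfix.
pose B := [set i : 'I_n | (i < m)%N]%SET.
have Bm : #|B| = m.
  rewrite -sum1_card; under eq_bigl do rewrite inE.
  by rewrite (big_ord_narrow mn) sum1_card card_ord.
have := vD (~: B); rewrite cardsCs finset.setCK card_ord Bm eqxx => /(_ isT).
rewrite sub_kermx /sym_sum finset.setCK mulmx_sumr (eq_bigr _ vfix) sumr_const.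
rewrite -scaler_nat scaler_eq0 pnatr_eq0.
by rewrite card_perm Bm (gtn_eqF (fact_gt0 _)) => /eqP.
Qed.

Hypothesis atr : forall g, \tr (a g) = (g == 1%g)%:R * n`!%:R.

(** Divided by [f], the sum is idempotent, so its rank is its trace; only the identity contributes,
    giving [n! / f]. *)
Lemma rank_sym_sum (A : {set 'I_n}) : \rank (sym_sum A) = (n ^_ #|A|)%N.
Proof.
set f := (n - #|A|)`!%N.
have fE : #|[pred h | perm_on (~: A) h]| = f.
  by rewrite card_perm cardsCs finset.setCK card_ord.
have f0 : (f%:R : C) != 0 by rewrite pnatr_eq0 -lt0n fact_gt0.
have ee : sym_sum A *m sym_sum A = f%:R *: sym_sum A.
  rewrite {1}/sym_sum mulmx_suml scaler_nat -fE -sumr_const.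
  apply: eq_bigr => g gA; rewrite /sym_sum mulmx_sumr.
  rewrite [RHS](reindex_inj (mulgI g)) /=; apply: eq_big => [h|h _].
    apply/idP/idP => [hA|ghA]; first exact: perm_onM.
    by rewrite -[h](mulKg g) perm_onM // perm_onV.
  by rewrite aM.
have /mxtrace_idem : (f%:R^-1 *: sym_sum A) *m (f%:R^-1 *: sym_sum A)
    = f%:R^-1 *: sym_sum A.
  by rewrite -scalemxAl -scalemxAr ee [X in _ *: X]scalerA mulVf // scale1r.
rewrite mxrank_scale_nz ?invr_eq0 // linearZ /= /sym_sum linear_sum /=.
rewrite (bigD1 1%g) ?perm_on1 //= big1 => [|h /andP[_ /negPf h1]]; last first.
  by rewrite atr h1 mul0r.
rewrite addr0 atr eqxx mul1r => /(canRL (mulVKf f0)).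
rewrite -natrM => /eqP; rewrite eqr_nat => /eqP.
have An : (#|A| <= n)%N by rewrite -[n in leqRHS]card_ord max_card.
rewrite -(ffact_fact An) mulnC -/f => /eqP.
by rewrite eqn_pmul2l ?fact_gt0 // => /eqP <-.
Qed.

Lemma codim_sym_ker (j : nat) :
  (N <= \rank (sym_ker j) + 'C(n, j) * n ^ j)%N.
Proof.
have := codim_bigcap_kermx (fun A : {set 'I_n} => #|A| == j) sym_sum.
move=> /leq_trans; apply; rewrite leq_add2l.
rewrite (eq_bigr (fun=> n ^_ j)) => [|A /eqP Aj]; last by rewrite rank_sym_sum Aj.
rewrite sum_nat_const leq_mul ?leq_ffact_exp //.
by rewrite -[X in 'C(X, _)](card_ord n) -card_draws cardsE.
Qed.

End InvariantKernel.

(** * Counting large eigenvalues and bounding the trace *)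

Section TraceBound.

Variables (C : numClosedFieldType) (n N : nat).

(** The trace condition is the character of the regular representation; unlike the permutation
    matrices themselves, it survives the sign twist. *)
Definition unitary_action (a : {perm 'I_n} -> 'M[C]_N) : Prop :=
  [/\ a 1%g = 1%:M, forall g h, a (g * h)%g = a g *m a h,
      forall g, map_mx conjC (a g)^T = a g^-1%g &
      forall g, \tr (a g) = (g == 1%g)%:R * n`!%:R].

(** The twist negates every Jucys-Murphy element, so upper bounds on eigenvalues also give lower
    bounds. *)
Definition sign_twist (a : {perm 'I_n} -> 'M[C]_N) (g : {perm 'I_n}) :
  'M[C]_N := (-1) ^+ odd_perm g *: a g.

Lemma unitary_action_sign_twist (a : {perm 'I_n} -> 'M[C]_N) :
  unitary_action a -> unitary_action (sign_twist a).
Proof.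
case=> a1 aM aV atr; split => [|g h|g|g]; rewrite /sign_twist.
- by rewrite odd_perm1 expr0 scale1r.
- by rewrite odd_permM signr_addb aM -scalemxAl -scalemxAr scalerA.
- by rewrite odd_permV -aV linearZ /= map_mxZ rmorph_sign.
- rewrite linearZ /= atr; have [->|] := eqVneq g 1%g; last by rewrite !mul0r mulr0.
  by rewrite odd_perm1 expr0 mul1r.
Qed.

Lemma jm_sign_twist (a : {perm 'I_n} -> 'M[C]_N) (t : 'I_n) :
  jm (sign_twist a) t = - jm a t.
Proof.
rewrite /jm -sumrN; apply: eq_bigr => i it.
rewrite /sign_twist odd_tperm (_ : i != t) ?expr1 ?scaleN1r //.
by apply: contraTneq it => ->; rewrite ltnn.
Qed.

Variables t u : 'I_n.
Hypotheses (tu : t = u.+1 :> nat) (tn : n = t.+1 :> nat).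

Lemma eig_in_sym_ker (a : {perm 'I_n} -> 'M[C]_N) (j : nat) (x : C) :
  unitary_action a -> (j.+2 <= n)%N ->
  eig_in (sym_ker a j) (jm a t + jm a u) x ->
  exists2 z : int, x = z%:~R & z + 5 <= (n - j).*2%:Z.
Proof.
move=> [a1 aM aV atr] jn.
have Dst := stable_sym_ker aM j.
move=> /(eig_in_jm_sum a1 aM aV tu Dst)[z [z' [-> zz' Dt Du]]].
exists (z + z') => //.
have noinv (v : 'rV[C]_N) : (v <= sym_ker a j)%MS ->
    (forall g, perm_on [set i : 'I_n | (i < n - j)%N] g -> v *m a g = v) ->
    v = 0.
  move=> vD vfix; apply: (sym_ker_noinv (m := n - j)) vfix; first exact: leq_subr.
  by rewrite subKn // ltnW // ltnW.
have nj : (1 < n - j)%N by lia.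
have : z + 2 <= (n - j)%N%:Z.
  by apply: (eig_in_jm_bound a1 aM nj Dst noinv _ Dt); lia.
have : z' + 2 <= (n - j)%N%:Z.
  by apply: (eig_in_jm_bound a1 aM nj Dst noinv _ Du); lia.
(* Two distinct integers at most [n - j - 2] have sum at most [2 (n - j) - 5]. *)
by move: zz' => /eqP; lia.
Qed.

Lemma eig_jm_sum_le (a : {perm 'I_n} -> 'M[C]_N) (x : C) :
  unitary_action a -> eig_in 1%:M (jm a t + jm a u) x ->
  exists2 z : int, x = z%:~R & z + 3 <= n.*2%:Z.
Proof.
move=> [a1 aM aV atr].
have Dst g : stablemx 1%:M (a g) by exact: submx1.
move=> /(eig_in_jm_sum a1 aM aV tu Dst)[z [z' [-> _ Dt Du]]].
exists (z + z') => //.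
have [w /eqP] := eig_in_jm_int a1 aM Dst Dt.
rewrite eqr_int => /eqP <- zt.
have [w' /eqP] := eig_in_jm_int a1 aM Dst Du.
by rewrite eqr_int => /eqP <- zu; lia.
Qed.

Lemma eig_inN (D A : 'M[C]_N) (x : C) : eig_in D A x -> eig_in D (- A) (- x).
Proof. by case=> v [v0 vD vx]; exists v; rewrite mulmxN vx scaleNr. Qed.

Lemma mxtrace_jm_sum_le (a : {perm 'I_n} -> 'M[C]_N) (k : nat) :
  unitary_action a ->
  \tr ((jm a t + jm a u) ^+ k.*2)
    <= (\sum_(j < n.-1)
          2 * ('C(n, j) * n ^ j) * (n.*2 - 3 - j.*2) ^ k.*2)%N%:R.
Proof.
move=> ua; have ua' := unitary_action_sign_twist ua.
have [a1 aM aV atr] := ua.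
set M := jm a t + jm a u.
have M' : jm (sign_twist a) t + jm (sign_twist a) u = - M.
  by rewrite !jm_sign_twist opprD.
have Mn : M \is normalmx.
  apply/normalmxP; suff -> : map_mx conjC M^T = M by [].
  by rewrite /M linearD /= map_mxD !(jm_hermitian aV).
have Mst (D : 'M[C]_N) : (forall g, stablemx D (a g)) -> stablemx D M.
  by move=> Dst; apply: stablemxD; apply: stable_jm.
have /fin_all_exists[z dz] : forall i, exists z : int,
    spectral_diag M 0 i = z%:~R /\ (`|z| + 3 <= n.*2)%N.
  move=> i; have Mi := spectral_diag_eig i Mn.
  have [z dz zn] := eig_jm_sum_le ua Mi; exists z; split=> //.
  have := eig_inN Mi; rewrite -M' => /(eig_jm_sum_le ua')[z'].
  by rewrite dz -rmorphN /= => /eqP; rewrite eqr_int => /eqP <-; lia.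
rewrite mxtrace_exp_spectral //.
rewrite (eq_bigr (fun i => (`|z i| ^ k.*2)%N%:R)) => [|i _]; last first.
  have [-> _] := dz i.
  by rewrite natrX natr_absz intr_norm -mul2n !exprM real_normK // realz.
rewrite -natr_sum ler_nat.
(* [L j i] says that the [i]-th eigenvalue exceeds in absolute value the bound valid on
   [sym_ker a j]. The bounds for [M] and for [- M] each allow at most [C(n, j) n^j] exceptions. *)
pose L (j : nat) i := ((n - j).*2 < `|z i| + 5)%N.
have cardL (j : 'I_n.-1) : (#|[pred i | L j i]| <= 2 * ('C(n, j) * n ^ j))%N.
  have jn : (j.+2 <= n)%N by have := ltn_ord j; lia.
  pose Q (x : C) := `[< exists2 z : int, x = z%:~R & z + 5 <= (n - j).*2%:Z >].
  have cQ : (#|[pred i | ~~ Q (spectral_diag M 0%R i)]| <= 'C(n, j) * n ^ j)%N.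
    rewrite -(leq_add2r (\rank (sym_ker a j))).
    apply: leq_trans (_ : N <= _)%N; last by rewrite addnC codim_sym_ker.
    apply: card_spectral_diag => //; first exact/Mst/stable_sym_ker.
    by move=> x Dx; apply/asboolP; apply: eig_in_sym_ker Dx.
  have cQ' :
      (#|[pred i | ~~ Q (- spectral_diag M 0%R i)%R]| <= 'C(n, j) * n ^ j)%N.
    have [a1' aM' aV' atr'] := ua'.
    rewrite -(leq_add2r (\rank (sym_ker (sign_twist a) j))).
    apply: leq_trans (_ : N <= _)%N; last by rewrite addnC codim_sym_ker.
    apply: (card_spectral_diag (Q := fun x => Q (- x))) => //.
      rewrite -stablemxN -M'; apply: stablemxD;
        apply: stable_jm => g; exact: stable_sym_ker.
    move=> x Dx; apply/asboolP; apply: (eig_in_sym_ker ua' jn).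
    by rewrite M'; apply: eig_inN.
  rewrite mul2n -addnn; apply: leq_trans (leq_add cQ cQ').
  apply: leq_trans (_ : #|[predU [pred i | ~~ Q (spectral_diag M 0%R i)]
      & [pred i | ~~ Q (- spectral_diag M 0%R i)%R]]| <= _)%N.
    apply/subset_leq_card/fintype.subsetP => i; rewrite !inE /L => Li.
    rewrite -negb_and; apply/negP => /andP[/asboolP[w dw wn] /asboolP[w' dw' wn']].
    have [di _] := dz i; move: dw dw'; rewrite di -rmorphN /=.
    by move=> /eqP; rewrite eqr_int => /eqP zw /eqP; rewrite eqr_int => /eqP; lia.
  by rewrite -cardUI leq_addr.
apply: leq_trans (_ : \sum_i \sum_(j < n.-1) L j i * (n.*2 - 3 - j.*2) ^ k.*2 <= _)%N.
  apply: leq_sum => i _; have [_ zn] := dz i.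
  (* Each eigenvalue is charged to the largest [j] with [|z i| <= 2 n - 3 - 2 j]; maximality gives
     [L j i]. *)
  have j0n : ((n.*2 - 3 - `|z i|)./2 < n.-1)%N by lia.
  rewrite (bigD1 (Ordinal j0n)) //=; apply: leq_trans (leq_addr _ _).
  have -> : L (n.*2 - 3 - `|z i|)./2 i = true by rewrite /L; lia.
  by rewrite mul1n; case: (k) => [//|k']; rewrite leq_exp2r //; lia.
rewrite exchange_big /=; apply: leq_sum => j _.
rewrite -big_distrl /= leq_mul2r; apply/orP; right.
by apply: leq_trans (cardL j); rewrite -sum1_card [in leqRHS]big_mkcond /=.
Qed.

End TraceBound.

(** * Words and the regular representation *)

Section RegularAction.

Variables (C : numClosedFieldType) (gT : finGroupType).

(** The right regular representation: the basis row of [x] is sent to that of [x * g]. *)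
Definition regmx (g : gT) : 'M[C]_#|gT| :=
  \matrix_(i, j) ((enum_val i * g)%g == enum_val j)%:R.

Lemma sum_enum_val (F : gT -> C) : \sum_(i < #|gT|) F (enum_val i) = \sum_g F g.
Proof. by rewrite [RHS](reindex _ (onW_bij _ (@enum_val_bij gT))). Qed.

Lemma regmx1 : regmx 1%g = 1%:M.
Proof.
by apply/matrixP => i j; rewrite !mxE mulg1 (inj_eq (@enum_val_inj _ _)).
Qed.

Lemma regmxM (g h : gT) : regmx (g * h)%g = regmx g *m regmx h.
Proof.
apply/matrixP => i j; rewrite !mxE.
under eq_bigr do rewrite !mxE.
rewrite (sum_enum_val (fun x => (enum_val i * g == x)%g%:R
  * (x * h == enum_val j)%g%:R)).
rewrite (bigD1 (enum_val i * g)%g) //= eqxx mul1r mulgA big1 ?addr0 // => x.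
by rewrite eq_sym => /negPf ->; rewrite mul0r.
Qed.

Lemma regmxV (g : gT) : map_mx conjC (regmx g)^T = regmx g^-1%g.
Proof.
apply/matrixP => i j; rewrite !mxE conjC_nat; congr (nat_of_bool _)%:R.
by rewrite (can2_eq (mulgK g) (mulgKV g)) eq_sym.
Qed.

Lemma mxtrace_regmx (g : gT) : \tr (regmx g) = (g == 1%g)%:R * #|gT|%:R.
Proof.
rewrite /mxtrace (eq_bigr (fun=> (g == 1%g)%:R)) => [|i _]; last first.
  by rewrite mxE -[X in _ == X]mulg1 (inj_eq (mulgI _)).
by rewrite sumr_const card_ord mulr_natr.
Qed.

Lemma sum_regmxE (c : gT -> C) i j :
  (\sum_g c g *: regmx g) i j = c ((enum_val i)^-1 * enum_val j)%g.
Proof.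
rewrite summxE (bigD1 ((enum_val i)^-1 * enum_val j)%g) //= big1 => [|g gN].
  by rewrite !mxE mulKVg eqxx mulr1 addr0.
rewrite !mxE (_ : _ == _ = false) ?mulr0 //; apply/negbTE.
by apply: contraNneq gN => <-; rewrite mulKg.
Qed.

(** The unnormalized convolution power of the indicator of [S]. Being a natural number, it carries
    bounds from [algC] over to [R]. *)
Fixpoint word_count (S : {set gT}) (k : nat) (g : gT) : nat :=
  if k is k'.+1 then \sum_h ((g * h^-1)%g \in S) * word_count S k' h
  else (g == 1%g).

Lemma expr_sum_regmx (S : {set gT}) (k : nat) :
  (\sum_(g in S) regmx g) ^+ k = \sum_g (word_count S k g)%:R *: regmx g.
Proof.
elim: k => [|k IHk].
  rewrite expr0 (bigD1 1%g) //= eqxx scale1r regmx1 big1 ?addr0 // => g.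
  by move=> /negPf ->; rewrite scale0r.
rewrite exprS IHk -mulmxE mulmx_sumr /=.
under [RHS]eq_bigr do rewrite natr_sum scaler_suml.
rewrite [RHS]exchange_big /=; apply: eq_bigr => h _.
rewrite [RHS](reindex_inj (mulIg h)) /= mulmx_suml big_mkcond /=.
apply: eq_bigr => g _; rewrite mulgK; case: (g \in S).
  by rewrite mul1n -scalemxAr regmxM.
by rewrite mul0n scale0r.
Qed.

Lemma sum_word_count (S : {set gT}) (k : nat) :
  (\sum_g word_count S k g = #|S| ^ k)%N.
Proof.
elim: k => [|k IHk] /=.
  by rewrite (bigD1 1%g) //= eqxx big1 // => g /negPf ->.
rewrite exchange_big /= expnS -IHk big_distrr /=; apply: eq_bigr => h _.
rewrite -big_distrl /= (reindex_inj (mulIg h)) /=; congr (_ * _)%N.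
by rewrite -sum1_card [RHS]big_mkcond; apply: eq_bigr => g _; rewrite mulgK.
Qed.

(* The trace of [A *m A^*] is the sum of the squared norms of its entries. *)
Lemma sum_sqr_word_count (S : {set gT}) (k : nat) : S^-1%g = S ->
  \tr ((\sum_(g in S) regmx g) ^+ k.*2)
    = (#|gT| * \sum_g word_count S k g ^ 2)%N%:R.
Proof.
move=> SV; set A := \sum_(g in S) regmx g.
have AH : map_mx conjC A^T = A.
  rewrite /A !raddf_sum /= -[in RHS]SV.
  rewrite [RHS](reindex_inj invg_inj) /=; apply: eq_big => g.
    by rewrite mem_invg invgK.
  by rewrite regmxV.
have AkH : map_mx conjC (A ^+ k)^T = A ^+ k.
  elim: k => [|k IHk]; first by rewrite expr0 trmx1 map_mx1.
  by rewrite exprSr -mulmxE trmx_mul map_mxM AH IHk mulmxE -exprS exprSr.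
rewrite -addnn exprD -{2}AkH -mulmxE /mxtrace.
(* Every row of [A ^+ k] is a rearrangement of the word counts, whence the factor [#|gT|]. *)
under [LHS]eq_bigr => i _.
  rewrite mxE; under eq_bigr do rewrite !mxE expr_sum_regmx sum_regmxE conjC_nat.
  rewrite (sum_enum_val (fun x => (word_count S k ((enum_val i)^-1 * x)%g)%:R
    * (word_count S k ((enum_val i)^-1 * x)%g)%:R)).
  rewrite (reindex_inj (mulgI (enum_val i))) /=.
  under eq_bigr do rewrite mulKg -natrM.
  over.
by rewrite sumr_const card_ord -natr_sum -[_ *+ #|_|]mulr_natl -natrM.
Qed.

End RegularAction.

(** * The support of [P] and transpositions of the top points *)

Section Support.

Variables (n : nat) (t u : 'I_n).
Hypotheses (tu : t = u.+1 :> nat) (tn : n = t.+1 :> nat).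

Local Notation s := (tperm u t).

Definition supp : {set {perm 'I_n}} := [set g | in_supp g]%SET.

Definition top_tperms : {set {perm 'I_n}} :=
  [set tperm i u | i : 'I_n & (i < u)%N]%SET
  :|: [set tperm i t | i : 'I_n & (i < t)%N]%SET.

Lemma neq_ord_lt (i j : 'I_n) : (i < j)%N -> i != j.
Proof. by apply: contraTneq => ->; rewrite ltnn. Qed.

Lemma cycle3E (T : finType) (i a b : T) : i != b -> a != b ->
  cycle3 i a b = (tperm a b * tperm i a)%g.
Proof.
move=> ib ab; have := tpermJ i b (tperm i a); rewrite conjgE tpermV tpermL.
rewrite tpermD // 1?eq_sym // => <-.
by rewrite /cycle3 -!mulgA tperm2 mulg1.
Qed.

(** Left multiplication by [s] sends the identity to [(u t)] and the two 3-cycles through [i] to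
    [(i u)] and [(i t)]. *)
Lemma in_suppE (g : {perm 'I_n}) : in_supp g = ((s * g)%g \in top_tperms).
Proof.
have ut : u != t by apply: neq_ord_lt; rewrite tu.
apply/idP/idP.
  case/orP => [/eqP ->|].
    rewrite mulg1 inE; apply/orP; right; apply/imsetP; exists u => //.
    by rewrite inE tu.
  case/existsP => i /existsP[a /existsP[b /and4P[iu /eqP au /eqP bt]]].
  have {au} -> : a = u by apply/val_inj; rewrite au /=; lia.
  have {bt} -> : b = t by apply/val_inj; rewrite bt /=; lia.
  have {}iu : (i < u)%N by lia.
  have it : (i < t)%N by lia.
  case/orP => /eqP ->.
    rewrite cycle3E ?(neq_ord_lt it) // mulgA tperm2 mul1g.
    by rewrite inE; apply/orP; left; apply/imsetP; exists i; rewrite ?inE.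
  rewrite cycle3E ?(neq_ord_lt iu) // 1?eq_sym // tpermC mulgA tperm2 mul1g.
  by rewrite inE; apply/orP; right; apply/imsetP; exists i; rewrite ?inE.
have gE (h : {perm 'I_n}) : (s * g = h -> g = s * h)%g.
  by move=> <-; rewrite mulgA tperm2 mul1g.
have supp3 (i : 'I_n) : (i < u)%N ->
    (g == cycle3 i u t) || (g == cycle3 i t u) -> in_supp g.
  move=> iu gi; apply/orP; right; apply/existsP; exists i.
  apply/existsP; exists u; apply/existsP; exists t.
  by rewrite gi andbT /=; apply/and3P; split; lia.
rewrite inE => /orP[] /imsetP[i]; rewrite inE => ilt /gE ge.
  apply: (supp3 i ilt); rewrite ge cycle3E ?eqxx //.
  by apply: neq_ord_lt; rewrite tu ltnS ltnW.
have [iu|iu] := eqVneq i u; first by rewrite ge iu tperm2 /in_supp eqxx.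
have {}ilt : (i < u)%N by rewrite -(inj_eq val_inj) /= in iu; lia.
apply: (supp3 i ilt); rewrite ge [X in _ || X](_ : _ = true) ?orbT //.
by rewrite cycle3E ?(neq_ord_lt ilt) // 1?eq_sym // [tperm t u]tpermC eqxx.
Qed.

Lemma suppV : (supp^-1)%g = supp.
Proof.
have sub (g : {perm 'I_n}) : in_supp g -> in_supp g^-1%g.
  case/orP => [/eqP ->|]; first by rewrite invg1 /in_supp eqxx.
  case/existsP => i /existsP[a /existsP[b /and4P[ia ab ib gi]]].
  apply/orP; right; apply/existsP; exists i; apply/existsP; exists a.
  apply/existsP; exists b; rewrite ia ab ib /= /cycle3.
  by case/orP: gi => /eqP ->; rewrite invMg !tpermV eqxx ?orbT.
by apply/setP => g; rewrite mem_invg !inE; apply/idP/idP => /sub //; rewrite invgK.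
Qed.

Lemma supp_even (g : {perm 'I_n}) : in_supp g -> ~~ odd_perm g.
Proof.
case/orP => [/eqP ->|]; first by rewrite odd_perm1.
case/existsP => i /existsP[a /existsP[b /and4P[ia /eqP ab /eqP ib]]].
have /andP[iNa iNb] : (i != a) && (i != b).
  by rewrite -!(inj_eq val_inj) /= ab ib; lia.
by case/orP => /eqP ->; rewrite odd_permM !odd_tperm iNa iNb.
Qed.

Lemma big_top_tperms (R : Type) (idx : R) (op : Monoid.com_law idx)
    (F : {perm 'I_n} -> R) :
  \big[op/idx]_(g in top_tperms) F g
    = op (\big[op/idx]_(i < n | (i < u)%N) F (tperm i u))
         (\big[op/idx]_(i < n | (i < t)%N) F (tperm i t)).
Proof.
rewrite /top_tperms; set A := [set _ | _ : _ & _]%SET.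
set B := [set tperm i t | i : _ & _]%SET.
rewrite (eq_bigl [in [predU A & B]]) => [|g]; last by rewrite !inE.
rewrite bigU /=; last first.
  apply/pred0P => g /=; apply/negP.
  case/andP => /imsetP[i]; rewrite inE => iu -> /imsetP[j]; rewrite inE => jt.
  (* The two families are disjoint: [(i u)] fixes [t], while [(j t)] moves it. *)
  move=> /permP/(_ t); rewrite tpermR tpermD.
  - by move=> tj; rewrite tj ltnn in jt.
  - by apply: neq_ord_lt; rewrite tu ltnS ltnW.
  - by apply: neq_ord_lt; rewrite tu.
congr (op _ _); rewrite big_imset /=; try by apply: eq_bigl => i; rewrite inE.
  by move=> i j _ _ /permP/(_ u); rewrite !tpermR.
by move=> i j _ _ /permP/(_ t); rewrite !tpermR.
Qed.

Lemma big_supp (R : Type) (idx : R) (op : Monoid.com_law idx)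
    (F : {perm 'I_n} -> R) :
  \big[op/idx]_(g in supp) F g
    = op (\big[op/idx]_(i < n | (i < u)%N) F (s * tperm i u)%g)
         (\big[op/idx]_(i < n | (i < t)%N) F (s * tperm i t)%g).
Proof.
rewrite -(big_top_tperms _ (fun g => F (s * g)%g)).
rewrite (reindex_inj (mulgI s)) /=; apply: eq_bigl => g.
by rewrite inE in_suppE mulgA tperm2 mul1g.
Qed.

Lemma card_supp : #|supp| = (n.*2 - 3)%N.
Proof.
rewrite -sum1_card (big_supp _ (fun=> 1%N)).
have card_lt (v : 'I_n) : (\sum_(i < n | (i < v)%N) 1 = v)%N.
  by rewrite (big_ord_narrow (ltnW (ltn_ord v))) sum1_card card_ord.
rewrite !card_lt /=; lia.
Qed.

(* With [s] the transposition of the two top points, the sum of the support is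
   [s] times the sum of all transpositions moving a top point, and the two
   factors commute. *)
Lemma expr_sum_supp (C : numClosedFieldType) (N k : nat)
    (a : {perm 'I_n} -> 'M[C]_N) :
  a 1%g = 1%:M -> (forall g h, a (g * h)%g = a g *m a h) ->
  (\sum_(g in supp) a g) ^+ k.*2 = (jm a t + jm a u) ^+ k.*2.
Proof.
move=> a1 aM; rewrite (big_supp _ a) /=.
have -> : \sum_(i < n | (i < u)%N) a (s * tperm i u)%g = a s *m jm a u.
  by rewrite /jm mulmx_sumr; apply: eq_bigr => i _; rewrite aM.
have -> : \sum_(i < n | (i < t)%N) a (s * tperm i t)%g = a s *m jm a t.
  by rewrite /jm mulmx_sumr; apply: eq_bigr => i _; rewrite aM.
rewrite -mulmxDr [jm a u + _]addrC.
have s2 : a s *m a s = 1%:M := a_tperm2 a1 aM u t.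
have sC : a s *m (jm a t + jm a u) = (jm a t + jm a u) *m a s.
  have E := jm_swap a1 aM tu.
  have E' : jm a u *m a s = a s *m jm a t - 1%:M.
    by rewrite -(jm_rec aM tu) mulmxDr s2 !mulmxA s2 mul1mx addrK.
  by rewrite mulmxDr mulmxDl E E' addrCA addrA.
rewrite -mul2n !exprM; congr (_ ^+ k).
by rewrite !expr2 -!mulmxE {1}sC -mulmxA (mulmxA (a s)) s2 mul1mx.
Qed.

Lemma sum_sqr_word_count_supp (k : nat) :
  (n`! * \sum_g word_count supp k g ^ 2
    <= \sum_(j < n.-1)
         2 * ('C(n, j) * n ^ j) * (n.*2 - 3 - j.*2) ^ k.*2)%N.
Proof.
have N_fact : #|{perm 'I_n}| = n`! by rewrite card_Sn.
have ua : unitary_action (regmx algC (gT := {perm 'I_n})).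
  split; [exact: regmx1|exact: regmxM|exact: regmxV|move=> g].
  by rewrite mxtrace_regmx N_fact.
have [a1 aM _ _] := ua.
rewrite -(ler_nat algC) -{1}N_fact -sum_sqr_word_count ?suppV //.
rewrite expr_sum_supp //; exact: mxtrace_jm_sum_le.
Qed.

End Support.

(** * Total variation distance *)

(* Cauchy-Schwarz against the signs [+1] on [A] and [-1] off [A] gives
   [(2 (mu A - U A))^2 <= #|T| * \sum (mu - U)^2]. *)
Lemma tv_dist_uniform_le (R : realType) (T : finType) (mu : T -> R) (b : R) :
  0 <= b -> (0 < #|T|)%N -> \sum_x mu x = 1 ->
  #|T|%:R * (\sum_x mu x ^+ 2) <= 1 + 4 * b ^+ 2 ->
  tv_dist mu (@uniform_dist R T) <= b.
Proof.
move=> b0 T0 mu1 mu2; apply: ge_sup.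
  by exists `|mass mu finset.set0 - mass (@uniform_dist R T) finset.set0|, finset.set0.
move=> _ [A _ <-]; rewrite /mass -sumrB /uniform_dist.
set N : R := #|T|%:R in mu2 *; have N0 : 0 < N by rewrite ltr0n.
pose d x := mu x - N^-1; rewrite -[X in `|X|]/(\sum_(x in A) d x).
have d0 : \sum_x d x = 0.
  by rewrite sumrB mu1 sumr_const -[_ *+ _]mulr_natr mulVf ?gt_eqF ?subrr.
have dd : N * (\sum_x d x ^+ 2) = N * (\sum_x mu x ^+ 2) - 1.
  rewrite (eq_bigr (fun x => mu x ^+ 2 + (- 2 * N^-1 * mu x + N^-2))); last first.
    by move=> x _; rewrite /d; field; rewrite gt_eqF.
  rewrite !big_split /= -mulr_sumr mu1 sumr_const -[_ *+ _]mulr_natr.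
  by field; rewrite gt_eqF.
set S := \sum_(x in A) d x.
pose e x : R := if x \in A then 1 else -1.
have eS : \sum_x e x * d x = 2 * S.
  have := d0; rewrite (bigID (mem A)) /= -/S => d0'.
  rewrite (bigID (mem A)) /= (eq_bigr d) => [|x xA]; last by rewrite /e xA mul1r.
  rewrite -/S (eq_bigr (fun x => - d x)) => [|x /negPf xA].
    by rewrite sumrN; lra.
  by rewrite /e xA mulN1r.
(* The subtracted multiple of [e] is the orthogonal projection of [d], since [e] has squared norm
   [N] and inner product [2 * S] with [d]. *)
have : 0 <= \sum_x (d x - (2 * S / N) * e x) ^+ 2.
  by apply: sumr_ge0 => x _; apply: sqr_ge0.
rewrite (eq_bigr (fun x => d x ^+ 2 + ((- (4 * S / N)) * (e x * d x)
    + (2 * S / N) ^+ 2))); last first.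
  move=> x _; have e2 : e x ^+ 2 = 1 by rewrite /e; case: ifP => _; rewrite ?sqrrN expr1n.
  rewrite sqrrB exprMn e2; ring.
rewrite !big_split /= -mulr_sumr eS sumr_const -[_ *+ #|_|]mulr_natr -[#|_|%:R]/N => dS.
have S2 : (2 * S) ^+ 2 <= N * \sum_x d x ^+ 2.
  move: dS; rewrite -(ler_pM2l N0) mulr0 => dS; rewrite -subr_ge0.
  suff -> : N * \sum_x d x ^+ 2 - (2 * S) ^+ 2 = N * (\sum_x d x ^+ 2 +
    (- (4 * S / N) * (2 * S) + (2 * S / N) ^+ 2 * N)). by [].
  by field; rewrite gt_eqF.
rewrite -(@ler_pXn2r _ 2) ?nnegrE // real_normK ?num_real //.
by move: S2; rewrite dd exprMn; lra.
Qed.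

(** * The walk on the alternating group *)

Section WalkOnAlt.

Variable R : realType.
Variable n : nat.
Hypothesis n3 : (3 <= n)%N.

Local Notation D := ((n.*2 - 3)%N%:R : R).

Let tn : (n.-1 < n)%N. Proof. by lia. Qed.
Let un : (n.-2 < n)%N. Proof. by lia. Qed.
Let t := Ordinal tn.
Let u := Ordinal un.
Let tu : t = u.+1 :> nat. Proof. by rewrite /=; lia. Qed.
Let nt : n = t.+1 :> nat. Proof. by rewrite /=; lia. Qed.

Lemma D_gt0 : 0 < D. Proof. by rewrite ltr0n; lia. Qed.

(** This lets sums over the alternating group be replaced by sums over all permutations. *)
Lemma word_count_odd (k : nat) (g : {perm 'I_n}) :
  g \notin ('Alt_('I_n))%g -> word_count (supp n) k g = 0%N.
Proof.
rewrite Alt_even negbK; elim: k g => [|k IHk] g /= godd.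
  by case: eqP godd => // ->; rewrite odd_perm1.
apply: big1 => h _; rewrite inE; case: (boolP (in_supp _)) => // gh.
rewrite IHk ?muln0 //.
have := supp_even tu nt gh.
by rewrite odd_permM odd_permV godd addTb negbK.
Qed.

Lemma sum_altT (S : nmodType) (F : {perm 'I_n} -> S) :
  \sum_(x : altT n) F (sgval x) = \sum_(g in ('Alt_('I_n))%g) F g.
Proof.
rewrite [RHS](reindex (@sgval _ ('Alt_('I_n))%G)) /=.
  by apply: eq_bigl => x; rewrite subgP.
by exists (subg _) => x; [rewrite sgvalK|exact: subgK].
Qed.

Lemma conv_powE (k : nat) (x : altT n) :
  conv_pow (@P R n) k x = (word_count (supp n) k (sgval x))%:R / D ^+ k.
Proof.
have DE : 2 * n%:R - 3 = D.
  by rewrite natrB -?mul2n ?natrM //; lia.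
elim: k x => [|k IHk] x /=.
  have -> : (x == 1%g) = (sgval x == 1%g); last by rewrite expr0 divr1.
  by apply/eqP/eqP => [->|x1] //; apply: (can_inj sgvalK).
transitivity (\sum_(y : altT n) (((sgval x * (sgval y)^-1)%g \in supp n)
    * word_count (supp n) k (sgval y))%N%:R / D ^+ k.+1).
  apply: eq_bigr => y _; rewrite IHk /P inE DE natrM.
  case: (in_supp _); rewrite ?mul0r // mul1r exprS invfM mulrA.
  by rewrite [D^-1 * _%:R]mulrC mulrA.
rewrite -mulr_suml -natr_sum; congr (_%:R / _).
rewrite (sum_altT (fun h => ((sgval x * h^-1)%g \in supp n)
    * word_count (supp n) k h)%N).
rewrite big_mkcond /=; apply: eq_bigr => h _.
by case: ifP => // /negbT /word_count_odd ->; rewrite muln0.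
Qed.

Lemma sum_conv_pow (k : nat) : \sum_x conv_pow (@P R n) k x = 1.
Proof.
under eq_bigr do rewrite conv_powE.
rewrite -mulr_suml -natr_sum (sum_altT (word_count (supp n) k)).
have -> : (\sum_(g in ('Alt_('I_n))%g) word_count (supp n) k g
    = \sum_g word_count (supp n) k g)%N.
  rewrite big_mkcond /=; apply: eq_bigr => h _.
  by case: ifP => // /negbT /word_count_odd ->.
rewrite sum_word_count (card_supp tu nt) natrX divff //.
by rewrite expf_neq0 // gt_eqF // D_gt0.
Qed.

Lemma sum_sqr_conv_pow (k : nat) :
  #|altT n|%:R * \sum_x conv_pow (@P R n) k x ^+ 2
    <= \sum_(j < n.-1) ('C(n, j) * n ^ j)%N%:R
         * ((n.*2 - 3 - j.*2)%N%:R / D) ^+ k.*2.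
Proof.
under eq_bigr do rewrite conv_powE exprMn exprVn -exprM muln2.
rewrite -mulr_suml mulrA ler_pdivrMr ?exprn_gt0 ?D_gt0 //.
(* The index 2 of the alternating group cancels the factor 2 that came from the sign twist. *)
have cA : (2 * #|altT n| = n`!)%N.
  rewrite -sum1_card (sum_altT (fun=> 1%N)) sum1_card.
  by rewrite card_Alt card_ord //; lia.
rewrite (sum_altT (fun g => (word_count (supp n) k g)%:R ^+ 2)).
rewrite -(ler_pM2l (ltr0Sn R 1)) mulrA -natrM cA.
apply: (@le_trans _ _ (n`! * \sum_g word_count (supp n) k g ^ 2)%N%:R).
  rewrite natrM ler_wpM2l // natr_sum [leLHS]big_mkcond ler_sum // => g _.
  by case: ifP => _; rewrite ?natrX.
apply: le_trans (_ : (\sum_(j < n.-1)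
  2 * ('C(n, j) * n ^ j) * (n.*2 - 3 - j.*2) ^ k.*2)%N%:R <= _).
  by rewrite ler_nat (sum_sqr_word_count_supp tu nt).
rewrite natr_sum mulr_suml mulr_sumr ler_sum // => j _.
rewrite exprMn exprVn -!mulrA mulVf ?mulr1 ?expf_neq0 ?gt_eqF ?D_gt0 //.
by rewrite [leLHS]natrM natrX [X in X * _]natrM -mulrA.
Qed.

End WalkOnAlt.

(** * Numerical estimates and conclusion *)

Lemma sum_pow_over_fact_le (R : realFieldType) (x : R) (m : nat) :
  0 <= x <= 1 -> \sum_(j < m) x ^+ j / j`!%:R <= 1 + 2 * x.
Proof.
case/andP=> x0 x1; case: m => [|m]; first by rewrite big_ord0; lra.
rewrite big_ord_recl /= expr0 divr1 lerD2l.
(* After the term [j = 0], bound [x ^+ i.+1] by [x] and compare the inverse factorials with a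
   geometric series of sum 2. *)
have fact_ge i : (2 ^ i <= i.+1`!)%N.
  elim: i => // i IHi; rewrite expnS factS leq_mul //.
have geom : \sum_(i < m) (2 ^ i)%:R^-1 = 2 - 2 / (2 ^ m)%:R :> R.
  elim: m => [|m IHm]; first by rewrite big_ord0 divr1 subrr.
  rewrite big_ord_recr /= IHm expnS natrM; field.
  by rewrite pnatr_eq0 expn_eq0.
apply: le_trans (_ : \sum_(i < m) x * (2 ^ i)%:R^-1 <= _); last first.
  rewrite -mulr_sumr geom mulrC ler_wpM2r // gerBl.
  by rewrite divr_ge0 // ler0n.
apply: ler_sum => i _; rewrite /bump /= add1n; apply: ler_pM.
- exact: exprn_ge0.
- by rewrite invr_ge0 ler0n.
- by rewrite exprS ler_piMr // exprn_ile1.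
- by rewrite lef_pV2 ?posrE ?ltr0n ?expn_gt0 ?fact_gt0 // ler_nat.
Qed.

(** From [1 - y <= e^{-y}] with [y = 2 j / D], the power is at most [e^{-2 c j} / n^{2 j}]; and
    [C(n, j) j! <= n^j] absorbs [n^{2 j}]. *)
Lemma walk_term_le (R : realType) (n k j : nat) (c : R) :
  (3 <= n)%N -> (j < n.-1)%N -> (n%:R - 3 / 2) * (ln n%:R + c) <= k%:R ->
  ('C(n, j) * n ^ j)%N%:R
      * ((n.*2 - 3 - j.*2)%N%:R / (n.*2 - 3)%N%:R : R) ^+ k.*2
    <= (expR (- c) ^+ 2) ^+ j / j`!%:R.
Proof.
move=> n3 jn kc; set D : R := (n.*2 - 3)%N%:R.
have n0 : 0 < n%:R :> R by rewrite ltr0n; lia.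
have D0 : 0 < D by rewrite ltr0n; lia.
have DE : D = 2 * (n%:R - 3 / 2).
  by rewrite /D natrB -?mul2n ?natrM; [field|lia].
have ratio0 : 0 <= (n.*2 - 3 - j.*2)%N%:R / D.
  by rewrite divr_ge0 ?ler0n // ltW.
have ratio : (n.*2 - 3 - j.*2)%N%:R / D <= expR (- (2 * j%:R / D)).
  apply: le_trans (expR_ge1Dx _); rewrite natrB; last by lia.
  by rewrite -/D -mul2n natrM mulrBl divff ?gt_eqF.
have pow : ((n.*2 - 3 - j.*2)%N%:R / D) ^+ k.*2
    <= (expR (- c) ^+ 2) ^+ j / n%:R ^+ (j.*2).
  apply: le_trans (_ : expR (- (2 * j%:R / D)) ^+ k.*2 <= _).
    by rewrite lerXn2r // nnegrE ?expR_ge0.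
  have -> : (expR (- c) ^+ 2) ^+ j / n%:R ^+ j.*2
      = expR (j.*2%:R * - (ln n%:R + c)).
    rewrite expRM_natl opprD expRD [expR (- ln _)]expRN lnK ?posrE // [RHS]exprMn -exprM mul2n.
    by rewrite exprVn mulrC.
  rewrite -expRM_natl ler_expR !mulrN lerN2 -!mul2n !natrM.
  have -> : 2 * k%:R * (2 * j%:R / D) = 2 * j%:R * (k%:R / (D / 2)).
    by field; rewrite gt_eqF.
  rewrite ler_wpM2l ?mulr_ge0 // ler_pdivlMr ?divr_gt0 //.
  apply: le_trans kc; rewrite mulrC DE; lra.
apply: le_trans (_ : ('C(n, j) * n ^ j)%N%:R
  * ((expR (- c) ^+ 2) ^+ j / n%:R ^+ j.*2) <= _); first exact: ler_wpM2l.
set X := _ ^+ j; rewrite mulrCA ler_wpM2l ?exprn_ge0 ?expR_ge0 //.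
rewrite ler_pdivrMr ?exprn_gt0 // mulrC ler_pdivlMr ?ltr0n ?fact_gt0 //.
rewrite -natrX -natrM ler_nat mulnAC bin_ffact -addnn expnD.
by rewrite leq_mul // leq_ffact_exp.
Qed.

Lemma tv_dist_walk_le (R : realType) (n k : nat) (c : R) :
  (3 <= n)%N -> 0 <= c -> (n%:R - 3 / 2) * (ln n%:R + c) <= k%:R ->
  tv_dist (conv_pow (@P R n) k) (@uniform_dist R (altT n))
    <= (Num.sqrt 2)^-1 * expR (- c).
Proof.
move=> n3 c0 kc; apply: tv_dist_uniform_le.
- by rewrite mulr_ge0 ?invr_ge0 ?sqrtr_ge0 ?expR_ge0.
- by apply/card_gt0P; exists 1%g.
- exact: sum_conv_pow.
apply: le_trans (sum_sqr_conv_pow R n3 k) _.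
apply: le_trans (ler_sum _ (fun j _ => walk_term_le n3 (ltn_ord j) kc)) _.
(* The factor [1 / sqrt 2] is what makes [4 b^2] equal to [2 e^{-2 c}]; the 1 accounts for the term
   [j = 0]. *)
have -> : 1 + 4 * ((Num.sqrt 2)^-1 * expR (- c)) ^+ 2
    = 1 + 2 * expR (- c) ^+ 2 :> R.
  by rewrite exprMn exprVn sqr_sqrtr //; field.
apply: sum_pow_over_fact_le; rewrite exprn_ge0 ?expR_ge0 //=.
by rewrite exprn_ile1 ?expR_ge0 // -expR0 ler_expR oppr_le0.
Qed.

Theorem theorem1p1 (R : realType) :
  (forall c : R, 0 < c ->
     exists delta : nat -> R,
       delta n @[n --> \oo] --> (0 : R) /\
       (forall n k : nat, (3 <= n)%N ->
          (n%:R - 3 / 2) * (ln n%:R + c) <= k%:R ->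
          tv_dist (conv_pow (@P R n) k) (@uniform_dist R (altT n))
            < (Num.sqrt 2)^-1 * expR (- c) + delta n))
  /\
  (forall eps : R, 0 < eps -> eps < 1 ->
     tv_dist
       (conv_pow (@P R n)
          `|Num.floor ((1 + eps) * (n%:R - 3 / 2) * ln n%:R)|%N)
       (@uniform_dist R (altT n)) @[n --> \oo] --> (0 : R)).
Proof.
split=> [c c0|eps eps0 _].
  (* The bound holds without error term; a positive null sequence only makes it strict. *)
  exists (@harmonic R); split; first exact: cvg_harmonic.
  move=> n k n3 kc; apply: le_lt_trans (tv_dist_walk_le n3 (ltW c0) kc) _.
  by rewrite ltrDl invr_gt0.
have tv_ge0 (T : finType) (mu nu : T -> R) : 0 <= tv_dist mu nu.
  rewrite /tv_dist; set E := (X in sup X).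
  (* [sup] takes the default value 0 when there is no supremum. *)
  have [hE|/sup_out -> //] := pselect (has_sup E).
  apply: le_trans (sup_upper_bound hE _); last by exists finset.set0.
  exact: normr_ge0.
apply/cvgrPdist_lt => e e0.
pose c := Num.max 0 (- ln e).
have ce : (Num.sqrt 2)^-1 * expR (- c) < e.
  have e_le : expR (- c) <= e.
    by rewrite -[leRHS]lnK ?posrE // ler_expR lerNl le_max lexx orbT.
  apply: lt_le_trans e_le; rewrite gtr_pMl ?expR_gt0 // invf_lt1 ?sqrtr_gt0 //.
  by rewrite -[ltLHS]sqrtr1 ltr_sqrt //; lra.
near=> n.
have n3 : (3 <= n)%N by near: n; exact: nbhs_infty_ge.
(* This gives [eps * ln n >= c + 1]: the [c] is the shift required by part (1), and the extra 1 pays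
   for the floor. *)
have nbig : expR ((c + 1) / eps) <= n%:R by near: n; exact: nbhs_infty_ger.
have nR : (3 : R) <= n%:R by rewrite ler_nat.
have n0 : 0 < n%:R :> R by lra.
have c0 : 0 <= c by rewrite le_max lexx.
have lnn : c + 1 <= eps * ln n%:R.
  by rewrite mulrC -ler_pdivrMr // -ler_expR lnK ?posrE.
have ln0 : 0 <= ln n%:R :> R.
  by rewrite ln_ge0 //; lra.
rewrite distrC subr0 ger0_norm //.
apply: le_lt_trans ce; apply: tv_dist_walk_le => //.
set x := (1 + eps) * _ * _.
have x0 : 0 <= x by rewrite /x !mulr_ge0 //; lra.
have xfl := floorD1_gt x.
have -> : `|Num.floor x|%N%:R = (Num.floor x)%:~R :> R.
  by rewrite natr_absz ger0_norm // floor_ge0.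
have : x - 1 <= (Num.floor x)%:~R by move: xfl; rewrite intrD; lra.
apply: le_trans; rewrite /x.
have : 1 * (c + 1) <= (n%:R - 3 / 2) * (eps * ln n%:R).
  by apply: ler_pM => //; lra.
have : 0 <= (n%:R - 5 / 2) * c by rewrite mulr_ge0 //; lra.
nra.
Unshelve. all: by end_near.
Qed.
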